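(* Let $\mathcal{X}\subseteq\mathbb{R}^n$, let $\mathcal{W}=[0,L_0]\times\cdots\times[0,L_{v-1}]\subset\mathbb{R}^v$ with $L_i>0$, let $g:\mathcal{X}\to\mathcal{W}$ be a fixed (Borel measurable) map, and let $\mu$ be a Borel probability measure on $\mathcal{W}$. Then the spectral ergodic cost function $\mathcal{E}_\mu$ (defined below) is a $\mu$-ergodic cost function; that is, for every continuous trajectory $x:\mathbb{R}^+\to\mathcal{X}$, if $\mathcal{E}_\mu(x|_{[0,T]})\to 0$ as $T\to\infty$, then the time-averaged measures $\mathcal{Q}_T$ of $x$ converge weakly to $\mu$ as $T\to\infty$, i.e. $\lim_{T\to\infty}\int_{\mathcal{W}}\phi\,d\mathcal{Q}_T=\int_{\mathcal{W}}\phi\,d\mu$ for every continuous $\phi:\mathcal{W}\to\mathbb{R}$.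
   Context: For a continuous trajectory $x:[0,T]\to\mathcal{X}$ (or the restriction $x|_{[0,T]}$ of $x:\mathbb{R}^+\to\mathcal{X}$), the time-averaged trajectory statistics measure is the probability measure on $\mathcal{W}$ given by $\mathcal{Q}_T(A)=\frac{1}{T}\,m\big((g\circ x)^{-1}(A)\cap[0,T]\big)$ for Borel $A\subset\mathcal{W}$, where $m$ is Lebesgue measure on $\mathbb{R}^+$; equivalently $\int_{\mathcal{W}}\phi\,d\mathcal{Q}_T=\frac1T\int_0^T\phi(g(x(t)))\,dt$. Let $\mathcal{K}^v=\mathbb{N}^v$ be the set of all integer frequency multi-indices $k=(k_0,\dots,k_{v-1})$, and for each $k$ let $F_k(w)=\frac{1}{h_k}\prod_{i=0}^{v-1}\cos\!\left(\frac{w_i k_i\pi}{L_i}\right)$, where $h_k>0$ is a normalizing constant. Let $\Lambda_k=(1+\|k\|_2)^{-\frac{v+1}{2}}$. The spectral ergodic cost of $x:[0,T]\to\mathcal{X}$ is $\mathcal{E}_\mu(x)=\sum_{k\in\mathcal{K}^v}\Lambda_k\left(\frac1T\int_0^T F_k(g(x(t)))\,dt-\int_{\mathcal{W}}F_k(w)\,d\mu(w)\right)^2.$ A $\mu$-ergodic cost function is a function $\mathcal{E}$ on finite-time trajectories such that for every trajectory $x:\mathbb{R}^+\to\mathcal{X}$, $\mathcal{E}(x|_{[0,T]})\to0$ as $T\to\infty$ implies $x$ is ergodic with respect to $\mu$, meaning $\mathcal{Q}_T$ converges weakly to $\mu$. *)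

(* Defs.v *)
From HB Require Import structures.
From mathcomp Require Import all_boot all_order all_algebra.
From mathcomp Require Import all_classical all_reals all_analysis.
Set Implicit Arguments. Unset Strict Implicit. Unset Printing Implicit Defensive.
Import Order.TTheory GRing.Theory Num.Theory.
Import numFieldNormedType.Exports.
Local Open Scope classical_set_scope.
Local Open Scope ring_scope.

Definition borelRV (R : realType) (k : nat) : Type :=
  g_sigma_algebraType (@open 'rV[R]_k).

Definition borel_set (R : realType) (k : nat) (A : set 'rV[R]_k) : Prop :=
  @measurable _ (borelRV R k) A.

(* g : X -> W is Borel measurable (w.r.t. the trace sigma-algebra on X). *)
Definition borel_measurable_on (R : realType) (n v : nat) (X : set 'rV[R]_n)
    (g : 'rV[R]_n -> 'rV[R]_v) : Prop :=
  forall B, borel_set B -> exists A, borel_set A /\ X `&` g @^-1` B = X `&` A.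

Definition box (R : realType) (v : nat) (L : 'I_v -> R) : set 'rV[R]_v :=
  [set w | forall i, 0 <= w 0 i <= L i].

Definition multi_index (v : nat) := 'I_v -> nat.

Definition Fk (R : realType) (v : nat) (L : 'I_v -> R) (h : multi_index v -> R)
    (k : multi_index v) (w : 'rV[R]_v) : R :=
  (h k)^-1 * \prod_(i < v) cos (w 0 i * (k i)%:R * pi / L i).

Definition Lambda (R : realType) (v : nat) (k : multi_index v) : R :=
  (1 + Num.sqrt (\sum_(i < v) ((k i)%:R : R) ^+ 2)) `^ (- ((v.+1)%:R / 2)).

(* time average (1/T) int_0^T phi(g(x t)) dt, i.e. int phi dQ_T *)
Definition time_avg (R : realType) (n v : nat) (g : 'rV[R]_n -> 'rV[R]_v)
    (x : R -> 'rV[R]_n) (T : R) (phi : 'rV[R]_v -> R) : R :=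
  T^-1 * Rintegral (@lebesgue_measure R) `[0, T] (fun t => phi (g (x t))).

Definition spectral_cost (R : realType) (n v : nat) (L : 'I_v -> R)
    (h : multi_index v -> R) (g : 'rV[R]_n -> 'rV[R]_v)
    (mu : probability (borelRV R v) R) (x : R -> 'rV[R]_n) (T : R) : \bar R :=
  (\esum_(k in [set: multi_index v])
     (Lambda R k * (time_avg g x T (Fk L h k)
                     - Rintegral mu (box L) (Fk L h k)) ^+ 2)%:E)%E.

(* Main.v *)
(* Each term of the spectral cost is bounded by the whole sum and Lambda_k > 0,
   so the time averages of every product of cosines converge.  The functions f
   for which all averages of f times such a product converge contain 1 and, by
   the product-to-sum formula, are stable under multiplication by
   cos (w_i pi / L_i).  They are dense in C(W): the maps
   w_i |-> (1 + cos (w_i pi / L_i)) / 2 are injective coordinates of the box W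
   with values in the unit cube, and the tensor Bernstein operator in these
   coordinates, sampled at the preimages of the grid, converges uniformly.
   Continuity on W and on [0, +oo[ is reduced to global continuity by composing
   with a retraction. *)

Require Import Defs.
From HB Require Import structures.
From mathcomp Require Import all_boot all_order all_algebra.
From mathcomp Require Import all_classical all_reals all_analysis.
From mathcomp Require Import measurable_realfun ring lra.
Set Implicit Arguments. Unset Strict Implicit. Unset Printing Implicit Defensive.
Import Order.TTheory GRing.Theory Num.Theory.
Import numFieldNormedType.Exports.
Local Open Scope classical_set_scope.
Local Open Scope ring_scope.

(** * Uniform continuity on a compact set in an additive form *)

(** The pairs with [|f x - f y| >= e] form a compact set [S] that misses the diagonal, so [rho] has
    a positive minimum there; [C] is the maximum of [|f x - f y|] on [S] divided by that minimum.
    With a sum of squares as [rho], the bound can be averaged against weights, as in Chebyshev's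
    inequality. *)
Lemma compact_modulus (R : realType) (T : topologicalType) (K : set T)
    (f : T -> R) (rho : T * T -> R) (e : R) :
  compact K -> continuous f -> continuous rho -> (forall p, 0 <= rho p) ->
  (forall x y, K x -> K y -> x <> y -> 0 < rho (x, y)) -> 0 < e ->
  exists2 C, 0 <= C &
    forall x y, K x -> K y -> `|f x - f y| <= e + C * rho (x, y).
Proof.
move=> cK cf crho rho_ge0 rho_gt0 e_gt0.
pose d (p : T * T) : R := `|f p.1 - f p.2|.
have cd : continuous d.
  move=> p; apply: cvg_norm; apply: cvgB.
    by apply: continuous_comp; [exact: cvg_fst|exact: cf].
  by apply: continuous_comp; [exact: cvg_snd|exact: cf].
pose S := (K `*` K) `&` d @^-1` [set r | e <= r].
have cS : compact S.
  apply: compact_closedI; first exact: compact_setX.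
  by apply: preimage_closed => [p _|]; [exact: cd|exact: closed_ge].
have [S0|/set0P S0] := eqVneq S set0.
  exists 0 => // x y Kx Ky; rewrite mul0r addr0 leNgt; apply/negP => /ltW ed.
  by have : S (x, y) by []; rewrite S0.
have [[a b] /set_mem [[/= Ka Kb] /= edab] minS] :=
  compact_EVT_min S0 cS (continuous_subspaceT crho).
have [m /set_mem [_ /= edm] maxS] :=
  compact_EVT_max S0 cS (continuous_subspaceT cd).
have rab : 0 < rho (a, b).
  apply: rho_gt0 => // ab; move: edab; rewrite /d ab /= subrr normr0.
  by rewrite leNgt e_gt0.
have dm_ge0 : 0 <= d m by exact: normr_ge0.
exists (d m / rho (a, b)); first by rewrite divr_ge0// ltW.
move=> x y Kx Ky; have [ed|/ltW de] := leP e (d (x, y)).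
  have Sxy : (x, y) \in S by apply/mem_set.
  apply: (le_trans (maxS _ Sxy)); rewrite -[leLHS]add0r lerD ?(ltW e_gt0)//.
  by rewrite mulrAC ler_pdivlMr// ler_wpM2l// minS.
by apply: (le_trans de); rewrite lerDl mulr_ge0// divr_ge0// ltW.
Qed.

(** * Bernstein polynomials and the moments of the binomial distribution *)

Definition bernstein (R : realType) (N m : nat) : {poly R} :=
  'C(N, m)%:R *: ('X^m * (1 - 'X) ^+ (N - m)).

Lemma horner_bernstein (R : realType) (N m : nat) (u : R) :
  (bernstein R N m).[u] = 'C(N, m)%:R * (u ^+ m * (1 - u) ^+ (N - m)).
Proof. by rewrite /bernstein hornerE hornerM hornerXn horner_exp !hornerE. Qed.

Lemma bernstein_ge0 (R : realType) (N m : nat) (u : R) :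
  0 <= u <= 1 -> 0 <= (bernstein R N m).[u].
Proof.
by move=> /andP[u0 u1]; rewrite horner_bernstein !mulr_ge0 ?exprn_ge0 ?subr_ge0.
Qed.

(** Pascal's rule in weak form: condition on one of [N.+1] Bernoulli trials, which succeeds with
    probability [u] and then shifts the count by one. *)
Lemma sum_bernsteinS (R : realType) (N : nat) (u : R) (f : nat -> R) :
  \sum_(m < N.+2) (bernstein R N.+1 m).[u] * f m =
  u * (\sum_(m < N.+1) (bernstein R N m).[u] * f m.+1) +
  (1 - u) * (\sum_(m < N.+1) (bernstein R N m).[u] * f m).
Proof.
rewrite [X in _ + _ * X](_ : _ =
   \sum_(m < N.+2) (bernstein R N m).[u] * f m); last first.
  by rewrite [RHS]big_ord_recr /= horner_bernstein bin_small// !mul0r addr0.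
rewrite !mulr_sumr [LHS]big_ord_recl [X in _ = _ + X]big_ord_recl.
rewrite [RHS]addrCA; congr (_ + _).
  by rewrite !horner_bernstein !bin0 !subn0 exprS; ring.
rewrite -big_split /=; apply: eq_bigr => i _; rewrite /bump add1n !horner_bernstein.
rewrite binS natrD subSS.
(* The last index is treated apart: there [N - i.+1] is truncated, but its binomial coefficient
   vanishes. *)
have [iN|iN] := ltnP i N; last first.
  by rewrite (@bin_small N i.+1)// !exprS; ring.
by rewrite -(subnSK iN) !exprS; ring.
Qed.

Lemma bernstein_sum1 (R : realType) (N : nat) (u : R) :
  \sum_(m < N.+1) (bernstein R N m).[u] = 1.
Proof.
elim: N => [|N IH]; first by rewrite big_ord1 horner_bernstein bin0 !expr0; ring.
have := sum_bernsteinS N u (fun=> 1).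
under eq_bigr do rewrite mulr1.
by move=> ->; under eq_bigr do rewrite mulr1; rewrite IH; ring.
Qed.

(* Stated about an arbitrary center [a] so that induction on [N] closes. *)
Lemma bernstein_variance (R : realType) (N : nat) (u a : R) :
  \sum_(m < N.+1) (bernstein R N m).[u] * (m%:R - a) ^+ 2 =
  (N%:R * u - a) ^+ 2 + N%:R * u * (1 - u).
Proof.
elim: N a => [|N IH] a.
  by rewrite big_ord1 horner_bernstein bin0 !expr0 /= !mulr0n; ring.
rewrite (sum_bernsteinS N u (fun m => (m%:R - a) ^+ 2)) IH.
under eq_bigr => m _.
  have -> : (m.+1%:R - a) = m%:R - (a - 1) by rewrite -natr1; ring.
  over.
by rewrite IH -natr1; ring.
Qed.

(** Centering at the mean [N%:R * u] leaves only the variance; after division by the square of [N]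
    it is [u * (1 - u) / N]. *)
Lemma bernstein_dispersion (R : realType) (N : nat) (u : R) :
  (0 < N)%N -> 0 <= u <= 1 ->
  \sum_(m < N.+1) (bernstein R N m).[u] * (u - m%:R / N%:R) ^+ 2 <= N%:R^-1.
Proof.
move=> N_gt0 /andP[u0 u1]; have N0 : 0 < N%:R :> R by rewrite ltr0n.
rewrite (_ : \sum_(m < N.+1) _ = N%:R ^- 2 * (N%:R * u * (1 - u))); last first.
  have := bernstein_variance N u (N%:R * u).
  rewrite subrr expr0n add0r => <-; rewrite mulr_sumr; apply: eq_bigr => m _.
  by field; rewrite gt_eqF.
rewrite (_ : _ * _ = N%:R^-1 * (u * (1 - u))); last by field; rewrite gt_eqF.
by rewrite ler_piMr ?invr_ge0 ?ltW//; nra.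
Qed.

(** Under a product of weights of total mass 1, a function of one coordinate sees only its marginal:
    attach [f] to the factor [i], distribute, and the other factors sum to 1. *)
Lemma sum_prod_marginal (R : comNzRingType) (I J : finType) (p : I -> J -> R)
    (f : J -> R) (i : I) : (forall l, \sum_m p l m = 1) ->
  \sum_(j : {ffun I -> J}) (\prod_l p l (j l)) * f (j i) = \sum_m p i m * f m.
Proof.
move=> p1.
transitivity (\prod_l \sum_m p l m * (if l == i then f m else 1)).
  rewrite bigA_distr_bigA /=; apply: eq_bigr => j _.
  by rewrite big_split /= -big_mkcond /= big_pred1_eq.
rewrite (bigD1 i)//= eqxx [X in _ * X]big1 ?mulr1// => l /negbTE ->.
by under eq_bigr do rewrite mulr1; exact: p1.
Qed.

(** * Density of the cosine algebra in the continuous functions on the box *)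

Section cosine_approximation.
Variables (R : realType) (v : nat) (L : 'I_v -> R).
Hypothesis L_gt0 : forall i, 0 < L i.

Definition angle (i : 'I_v) (w : 'rV[R]_v) : R := w 0 i * pi / L i.

Definition ucos (i : 'I_v) (w : 'rV[R]_v) : R := (1 + cos (angle i w)) / 2.

Lemma continuous_angle i : continuous (angle i).
Proof.
rewrite /angle => w; apply: (@continuousM R 'rV[R]_v); last exact: cst_continuous.
by apply: (@continuousM R 'rV[R]_v); [exact: coord_continuous|exact: cst_continuous].
Qed.

Lemma continuous_ucos i : continuous (ucos i).
Proof.
rewrite /ucos => w; apply: (@continuousM R 'rV[R]_v); last exact: cst_continuous.
apply: (@continuousD R R 'rV[R]_v); first exact: cst_continuous.
by apply: continuous_comp; [exact: continuous_angle|exact: continuous_cos].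
Qed.

Lemma ucos_itv i w : 0 <= ucos i w <= 1.
Proof.
by have := cos_geN1 (angle i w); have := cos_le1 (angle i w); rewrite /ucos; lra.
Qed.

Lemma angle_itv i w : box L w -> angle i w \in `[0, pi].
Proof.
move=> /(_ i)/andP[w0 wL]; rewrite in_itv /= /angle.
rewrite divr_ge0 ?mulr_ge0 ?pi_ge0 ?(ltW (L_gt0 i))//=.
by rewrite ler_pdivrMr// mulrC ler_wpM2l// pi_ge0.
Qed.

(** On the box every angle lies in [[0, pi]], where the cosine is injective. This makes the [rho] of
    [bernstein_approx] positive off the diagonal. *)
Lemma ucos_inj w w' : box L w -> box L w' ->
  (forall i, ucos i w = ucos i w') -> w = w'.
Proof.
move=> bw bw' E; apply/rowP => i; have := E i; rewrite /ucos => Ei.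
have /cos_inj : cos (angle i w) = cos (angle i w') by lra.
move=> /(_ (angle_itv i bw) (angle_itv i bw')); rewrite /angle.
have pi0 : pi != 0 :> R by rewrite gt_eqF// pi_gt0.
have L0 : L i != 0 by rewrite gt_eqF.
by move=> /(mulIf (invr_neq0 L0))/(mulIf pi0).
Qed.

Lemma compact_box : compact (box L).
Proof.
have := @rV_compact R v (fun i => `[0, L i]%classic).
rewrite (_ : [set w : 'rV[R]_v | _] = box L).
  by apply => i; exact: segment_compact.
by apply/seteqP; split=> w /= bw i; have := bw i; rewrite /= in_itv.
Qed.

(** The grid point [j / N] of the unit cube, pulled back to the box through the coordinates
    [ucos]. *)
Definition ucos_point (N : nat) (j : 'I_v -> nat) : 'rV[R]_v :=
  \row_i (acos (2 * ((j i)%:R / N%:R) - 1) * L i / pi).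

Lemma ratio_itv (N m : nat) : (0 < N)%N -> (m <= N)%N ->
  -1 <= 2 * (m%:R / N%:R : R) - 1 <= 1.
Proof.
move=> N0 mN; have : m%:R / N%:R <= 1 :> R.
  by rewrite ler_pdivrMr ?ltr0n// mul1r ler_nat.
have : 0 <= m%:R / N%:R :> R by [].
by lra.
Qed.

Lemma box_ucos_point N j : (0 < N)%N -> (forall i, (j i <= N)%N) ->
  box L (ucos_point N j).
Proof.
move=> N0 jN i; rewrite mxE; have r := ratio_itv N0 (jN i).
rewrite divr_ge0 ?mulr_ge0 ?acos_ge0 ?pi_ge0 ?(ltW (L_gt0 i))//=.
by rewrite ler_pdivrMr ?pi_gt0// mulrC ler_wpM2l ?(ltW (L_gt0 i))// acos_lepi.
Qed.

Lemma ucos_pointK N j i : (0 < N)%N -> (forall i, (j i <= N)%N) ->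
  ucos i (ucos_point N j) = (j i)%:R / N%:R.
Proof.
move=> N0 jN; have r := ratio_itv N0 (jN i).
rewrite /ucos /angle mxE.
rewrite (_ : _ * L i / pi * pi / L i = acos (2 * ((j i)%:R / N%:R) - 1)).
  by rewrite acosK ?in_itv//; field; rewrite pnatr_eq0 -lt0n.
have pi0 : pi != 0 :> R by rewrite gt_eqF// pi_gt0.
have L0 : L i != 0 by rewrite gt_eqF.
by rewrite divfK ?mulfK.
Qed.

(** The products of Bernstein values at [ucos i w] are nonnegative weights of sum 1. By
    [compact_modulus], [phi w] differs from the sample at [j] by at most [e / 2] plus [C] times the
    squared distance in the [ucos] coordinates; averaging that distance costs at most [1 / N] per
    coordinate. *)
Lemma bernstein_approx (phi : 'rV[R]_v -> R) (e : R) :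
  continuous phi -> 0 < e ->
  exists N : nat, forall w, box L w ->
    `|phi w - \sum_(j : {ffun 'I_v -> 'I_N.+1})
        phi (ucos_point N (fun i => j i)) *
        \prod_i (bernstein R N (j i)).[ucos i w]| <= e.
Proof.
move=> cphi e0.
pose rho (p : 'rV[R]_v * 'rV[R]_v) : R :=
  \sum_i (ucos i p.1 - ucos i p.2) ^+ 2.
have crho : continuous rho.
  apply: continuous_big => [|i _ p]; first exact: add_continuous.
  apply: (@continuous_comp _ _ _ (fun p => ucos i p.1 - ucos i p.2)
           (fun z : R => z ^+ 2)); last exact: exprn_continuous.
  apply: cvgB.
    by apply: continuous_comp; [exact: cvg_fst|exact: continuous_ucos].
  by apply: continuous_comp; [exact: cvg_snd|exact: continuous_ucos].
have rho_ge0 p : 0 <= rho p by apply: sumr_ge0 => i _; exact: sqr_ge0.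
have rho_gt0 w w' : box L w -> box L w' -> w <> w' -> 0 < rho (w, w').
  move=> bw bw' ww'; rewrite lt_neqAle rho_ge0 andbT eq_sym; apply/negP.
  rewrite /rho psumr_eq0; last by move=> i _; exact: sqr_ge0.
  move=> /allP /= E; apply: ww'; apply: ucos_inj => // i.
  by have := E i (mem_index_enum i); rewrite sqrf_eq0 subr_eq0 => /eqP.
have e20 : 0 < e / 2 by rewrite divr_gt0.
have [C C0 hC] := compact_modulus compact_box cphi crho rho_ge0 rho_gt0 e20.
(* Any [N] above [x] gives [C * v / N <= e / 2]; the strict bound also forces [N > 0] when [x] is
   zero. *)
pose x := C * v%:R / (e / 2).
have x0 : 0 <= x by rewrite divr_ge0 ?mulr_ge0// ltW.
pose N := Num.bound x.
have xN : x < N%:R by exact: archi_boundP.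
have N0R : 0 < N%:R :> R by exact: le_lt_trans xN.
have N0 : (0 < N)%N by rewrite -(ltr0n R).
exists N => w bw.
pose b (j : {ffun 'I_v -> 'I_N.+1}) :=
  \prod_i (bernstein R N (j i)).[ucos i w].
have p1 l : \sum_(m : 'I_N.+1) (bernstein R N m).[ucos l w] = 1.
  exact: bernstein_sum1.
have b1 : \sum_j b j = 1.
  rewrite /b -(bigA_distr_bigA (fun l (m : 'I_N.+1) =>
    (bernstein R N m).[ucos l w])) /=.
  by apply: big1 => l _; exact: p1.
have b0 j : 0 <= b j.
  by apply: prodr_ge0 => i _; apply: bernstein_ge0; exact: ucos_itv.
have jN (j : {ffun 'I_v -> 'I_N.+1}) i : (j i <= N)%N by rewrite -ltnS.
rewrite (_ : phi w = \sum_j phi w * b j); last by rewrite -mulr_sumr b1 mulr1.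
rewrite -sumrB.
apply: (le_trans (ler_norm_sum _ _ _)).
apply: (@le_trans _ _ (\sum_j (b j * (e / 2) +
    \sum_i C * (b j * (ucos i w - (j i)%:R / N%:R) ^+ 2)))).
  apply: ler_sum => j _; rewrite -/(b j) -mulrBl normrM (ger0_norm (b0 j)) mulrC.
  rewrite -mulr_sumr -mulr_sumr [X in _ <= _ + X]mulrCA -mulrDr ler_wpM2l//.
  have := hC _ _ bw (box_ucos_point N0 (jN j)); rewrite /rho /=.
  by under eq_bigr do rewrite (ucos_pointK _ N0 (jN j)).
(* Summing over the grid first reduces each coordinate to a one-variable dispersion. *)
rewrite big_split /= -mulr_suml b1 mul1r exchange_big /=.
have : \sum_i \sum_j C * (b j * (ucos i w - (j i)%:R / N%:R) ^+ 2) <=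
       \sum_(i < v) C / N%:R.
  apply: ler_sum => i _; rewrite -mulr_sumr ler_wpM2l//.
  rewrite (sum_prod_marginal (fun m : 'I_N.+1 => (ucos i w - m%:R / N%:R) ^+ 2)
    i p1).
  by apply: bernstein_dispersion => //; exact: ucos_itv.
rewrite sumr_const card_ord => S.
rewrite [leRHS](splitr e) lerD2l; apply: (le_trans S).
rewrite -[C / _ *+ _]mulr_natr mulrAC ler_pdivrMr// [leRHS]mulrC -ler_pdivrMr//.
exact: ltW.
Qed.

(** A linear space that contains 1 and is stable under multiplication by each cosine contains every
    tensor Bernstein sum. Keeping [D] abstract lets it be a convergence property rather than an
    explicit span. *)
Lemma cos_algebra_dense (D : ('rV[R]_v -> R) -> Prop) (phi : 'rV[R]_v -> R)
    (e : R) :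
  D (fun=> 1) ->
  (forall a f g, D f -> D g -> D (fun w => a * f w + g w)) ->
  (forall i f, D f -> D (fun w => cos (angle i w) * f w)) ->
  continuous phi -> 0 < e ->
  exists2 f, D f & forall w, box L w -> `|phi w - f w| <= e.
Proof.
move=> D1 Dlin Dcos cphi e0.
have D0 : D (fun=> 0).
  by have := Dlin (-1) _ _ D1 D1; congr D; apply/funext => w; ring.
have DZ a f : D f -> D (fun w => a * f w).
  by move=> Df; have := Dlin a _ _ Df D0; congr D; apply/funext => w; ring.
(* Horner's scheme: [(p * 'X + c)] at [u], times [f], is [p] at [u] times [u * f], plus [c * f];
   hence [f] must vary in the induction. *)
have Dpoly i (p : {poly R}) f : D f -> D (fun w => p.[ucos i w] * f w).
  elim/poly_ind: p f => [|p c IH] f Df.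
    by move: D0; congr D; apply/funext => w; rewrite horner0 mul0r.
  have Duf := Dlin (2^-1) _ _ (Dcos i _ Df) (DZ 2^-1 _ Df).
  have := Dlin 1 _ _ (IH _ Duf) (DZ c _ Df); congr D; apply/funext => w.
  rewrite hornerMXaddC; move: p.[_] => q.
  by rewrite /ucos; move: (cos _) => y; field.
have [N hN] := bernstein_approx cphi e0.
pose b (s : seq 'I_v) (j : {ffun 'I_v -> 'I_N.+1}) (w : 'rV[R]_v) :=
  \prod_(i <- s) (bernstein R N (j i)).[ucos i w].
have Db s j : D (b s j).
  elim: s => [|i s IH].
    by move: D1; congr D; apply/funext => w; rewrite /b big_nil.
  have := Dpoly i (bernstein R N (j i)) _ IH; congr D; apply/funext => w.
  by rewrite /b big_cons.
(* The approximation bound fixes the witness; its membership in [D] then follows by induction on the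
   list of grid indices. *)
eexists; last exact: hN.
elim: (index_enum {ffun 'I_v -> 'I_N.+1}) => [|j r IH].
  by move: D0; congr D; apply/funext => w; rewrite big_nil.
have := Dlin (phi (ucos_point N (fun i => j i))) _ _ (Db (index_enum 'I_v) j) IH.
by congr D; apply/funext => w; rewrite big_cons.
Qed.

End cosine_approximation.

(** * Retractions and measurability along the trajectory *)

Lemma continuous_comp_within (T U V : topologicalType) (A : set U) (f : T -> U)
    (g : U -> V) :
  continuous f -> (forall t, A (f t)) -> {within A, continuous g} ->
  continuous (g \o f).
Proof.
move=> cf Af /subspace_continuousP cg t W /= gW.
apply: (@filterS _ (nbhs t) _ _ _ _ (cf t _ (cg _ (Af t) _ gW))) => s /=.
by apply; exact: Af.
Qed.

(** The coordinatewise retraction onto the box; composing with it turns continuity on the box into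
    global continuity. *)
Definition clip (R : realType) (v : nat) (L : 'I_v -> R) (w : 'rV[R]_v) :
    'rV[R]_v :=
  \row_i Num.min (Num.max 0 (w 0 i)) (L i).

Lemma continuous_clip (R : realType) (v : nat) (L : 'I_v -> R) :
  continuous (@clip R v L).
Proof.
move=> w W [P Pw PW].
exists (fun i j => [set r | P i j (Num.min (Num.max 0 r) (L j))]); last first.
  move=> w' Pw'; apply: PW => i j; rewrite mxE ord1.
  by have := Pw' 0 j.
move=> i j; have := Pw i j; rewrite mxE (ord1 i) => Pij.
apply: (@continuous_min _ R (fun r => Num.max 0 r) (fun=> L j)) Pij.
  by apply: (@continuous_max _ R (fun=> 0) id); [exact: cvg_cst|exact: cvg_id].
exact: cvg_cst.
Qed.

Lemma box_clip (R : realType) (v : nat) (L : 'I_v -> R) (w : 'rV[R]_v) :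
  (forall i, 0 < L i) -> box L (clip L w).
Proof.
move=> L0 i; rewrite mxE ge_min lexx orbT andbT le_min.
by rewrite le_max lexx/= ltW.
Qed.

Lemma clip_id (R : realType) (v : nat) (L : 'I_v -> R) (w : 'rV[R]_v) :
  box L w -> clip L w = w.
Proof.
move=> bw; apply/rowP => i; rewrite mxE; have /andP[w0 wL] := bw i.
by rewrite (max_idPr w0) (min_idPl wL).
Qed.

Lemma continuous_borelRV_measurable (R : realType) (v : nat)
    (f : 'rV[R]_v -> R) :
  continuous f -> measurable_fun [set: borelRV R v] (f : borelRV R v -> R).
Proof.
move=> /continuousP cf; apply: (measurability _ (RGenOpens.measurableE R)).
move=> _ [_ [a [b ->] <-]]; rewrite setTI.
by apply: sub_sigma_algebra; apply: cf; exact: interval_open.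
Qed.

(** Freezing [x] at its initial value for negative times gives a globally continuous, hence Borel,
    map [x']. The preimage of [B] under [g] is a Borel set [A] only up to intersection with [X],
    which is harmless because the trajectory stays in [X]. *)
Lemma trajectory_measurable (R : realType) (n v : nat) (X : set 'rV[R]_n)
    (g : 'rV[R]_n -> 'rV[R]_v) (x : R -> 'rV[R]_n) (T : R) :
  borel_measurable_on X g -> {within `[0, +oo[, continuous x} ->
  (forall t, 0 <= t -> X (x t)) ->
  measurable_fun `[0, T] (fun t => g (x t) : borelRV R v).
Proof.
move=> mg cx Xx mD B mB.
pose x' := x \o (fun t : R => Num.max 0 t).
have cx' : continuous x'.
  apply: (@continuous_comp_within R R 'rV[R]_n `[0, +oo[%classic).
  - move=> t; apply: (@continuous_max _ R (fun=> 0) id).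
      exact: cvg_cst.
    exact: cvg_id.
  - by move=> t; rewrite /= in_itv /= andbT le_max lexx.
  - exact: cx.
have mx' : measurable_fun setT (x' : R -> borelRV R n).
  apply: (@measurability _ _ _ (borelRV R n) _ _ (@open 'rV[R]_n)) => //.
  move=> _ [U oU <-]; rewrite setTI.
  by apply: open_measurable; move/continuousP: cx'; exact.
have [A [mA XA]] := mg _ mB.
rewrite (_ : _ `&` _ = `[0, T] `&` x' @^-1` A).
  by apply: measurableI => //; rewrite -[X in measurable X]setTI; exact: mx'.
apply/seteqP; split=> t [/= tT]; move: (tT); rewrite in_itv /= => /andP[t0 _];
  rewrite /x' /= ?(max_idPr t0) => Bt; split=> //.
  have : (X `&` g @^-1` B) (x t) by split=> //; exact: Xx.
  by rewrite XA => -[].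
have : (X `&` A) (x t) by split=> //; exact: Xx.
by rewrite -XA => -[].
Qed.

Lemma measurable_box (R : realType) (v : nat) (L : 'I_v -> R) :
  borel_set (box L).
Proof.
rewrite /borel_set -[box L]setCK; apply: measurableC.
apply: sub_sigma_algebra; apply: closed_openC.
apply: compact_closed; last exact: compact_box.
exact: norm_hausdorff.
Qed.

(** * Integrals of continuous functions along a map into the box *)

Section box_integral.
Context {d : measure_display} {S : measurableType d} {R : realType}.
Variables (m : {measure set S -> \bar R}) (v : nat) (L : 'I_v -> R).
Variables (D : set S) (G : S -> 'rV[R]_v).
Hypotheses (mD : measurable D) (mD_fin : (m D < +oo)%E).
Hypotheses (GD : forall t, D t -> box L (G t)).
Hypothesis mG : measurable_fun D (G : S -> borelRV R v).

(** Continuity on a compact box gives boundedness, and [D] has finite measure. The section serves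
    both sides of the limit: Lebesgue measure on [[0, T]] with [g \o x], and [mu] on the box with
    the identity. *)
Lemma box_integrable (f : 'rV[R]_v -> R) : continuous f ->
  m.-integrable D (EFin \o (fun t => f (G t))).
Proof.
move=> cf; apply: measurable_bounded_integrable => //.
  apply: (measurableT_comp _ mG); exact: continuous_borelRV_measurable.
have /compact_bounded [M [Mreal fM]] : compact (f @` box L).
  apply: continuous_compact; last exact: compact_box.
  exact: continuous_subspaceT.
by exists M; split=> // r Mr t Dt; apply: (fM r Mr);
  exists (G t) => //; exact: GD.
Qed.

Lemma box_integral_linear (a : R) (f1 f2 : 'rV[R]_v -> R) :
  continuous f1 -> continuous f2 ->
  Rintegral m D (fun t => a * f1 (G t) + f2 (G t)) =
  a * Rintegral m D (fun t => f1 (G t)) + Rintegral m D (fun t => f2 (G t)).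
Proof.
move=> cf1 cf2; rewrite -RintegralZl//; last exact: box_integrable.
rewrite RintegralD//; last exact: box_integrable.
apply: (box_integrable (f := fun w => a * f1 w)) => w.
by apply: (@continuousM R 'rV[R]_v); [exact: cst_continuous|exact: cf1].
Qed.

Lemma box_integral_dist (f1 f2 : 'rV[R]_v -> R) (e : R) :
  continuous f1 -> continuous f2 ->
  (forall w, box L w -> `|f1 w - f2 w| <= e) ->
  `|Rintegral m D (fun t => f1 (G t)) - Rintegral m D (fun t => f2 (G t))|
    <= e * fine (m D).
Proof.
move=> cf1 cf2 f12.
have cB : continuous (fun w => f1 w - f2 w).
  by move=> w; apply: (@continuousB R R 'rV[R]_v); [exact: cf1|exact: cf2].
rewrite -RintegralB//; try exact: box_integrable.
apply: le_trans.
  apply: le_normr_Rintegral => //; exact: box_integrable cB.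
rewrite -Rintegral_cst//; apply: le_Rintegral => //.
- apply: (box_integrable (f := fun w => `|f1 w - f2 w|)) => w.
  by apply: (continuous_comp (cB w)); exact: norm_continuous.
- by apply: (box_integrable (f := fun=> e)) => w; exact: cst_continuous.
- by move=> t Dt; apply: f12; exact: GD.
Qed.

End box_integral.

(** * Products of cosines and the product-to-sum formula *)

(** [Fk] without its normalizing constant, so that the product-to-sum coefficients do not depend on
    [h]. *)
Definition cos_prod (R : realType) (v : nat) (L : 'I_v -> R)
    (k : multi_index v) (w : 'rV[R]_v) : R :=
  \prod_(i < v) cos (w 0 i * (k i)%:R * pi / L i).

Lemma continuous_cos_prod (R : realType) (v : nat) (L : 'I_v -> R) k :
  continuous (@cos_prod R v L k).
Proof.
apply: continuous_big => [|i _ w]; first exact: mul_continuous.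
apply: (@continuous_comp _ _ _ (fun w : 'rV[R]_v => w 0 i * (k i)%:R * pi / L i));
  last exact: continuous_cos.
do 3 (apply: (@continuousM R 'rV[R]_v); last exact: cst_continuous).
exact: coord_continuous.
Qed.

Definition set_index (v : nat) (k : multi_index v) (i : 'I_v) (m : nat) :
    multi_index v :=
  fun l => if l == i then m else k l.

Lemma cos_prodD1 (R : realType) (v : nat) (L : 'I_v -> R) k i m w :
  cos_prod L (set_index k i m) w =
  cos (angle L i w * m%:R) *
    \prod_(l < v | l != i) cos (w 0 l * (k l)%:R * pi / L l) :> R.
Proof.
rewrite /cos_prod (bigD1 i)//= /set_index eqxx /angle; congr (cos _ * _).
  by rewrite -!mulrA; congr (_ * _); rewrite [RHS]mulrA mulrC.
by apply: eq_bigr => l /negbTE ->.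
Qed.

(** Frequency zero is separate: the general formula would involve frequency -1, which is not a
    natural number. *)
Lemma cos_mul_cos_prod0 (R : realType) (v : nat) (L : 'I_v -> R) k i w :
  k i = 0%N ->
  cos (angle L i w) * cos_prod L k w = cos_prod L (set_index k i 1) w :> R.
Proof.
move=> ki; rewrite cos_prodD1 mulr1 /cos_prod (bigD1 i)//= ki.
by rewrite mulr0 !mul0r cos0 mul1r.
Qed.

(** With [a] the angle, [cos a * cos ((m + 1) a)] is half the sum of [cos ((m + 2) a)] and
    [cos (m a)]; the factors at other coordinates are unchanged. *)
Lemma cos_mul_cos_prodS (R : realType) (v : nat) (L : 'I_v -> R) k i m w :
  k i = m.+1 ->
  cos (angle L i w) * cos_prod L k w =
  2^-1 * cos_prod L (set_index k i m.+2) w +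
  2^-1 * cos_prod L (set_index k i m) w :> R.
Proof.
move=> ki; rewrite !cos_prodD1.
have -> : cos_prod L k w = cos (angle L i w * m.+1%:R) *
    \prod_(l < v | l != i) cos (w 0 l * (k l)%:R * pi / L l).
  by rewrite -cos_prodD1; apply: eq_bigr => l _; rewrite /set_index -ki;
     case: eqP => [->|].
have -> : angle L i w * m.+2%:R = angle L i w * m.+1%:R + angle L i w.
  by rewrite -natr1 mulrDr mulr1.
have -> : angle L i w * m%:R = angle L i w * m.+1%:R - angle L i w.
  by rewrite -natr1 mulrDr mulr1 addrK.
rewrite cosD cosB.
move: (cos _) (cos _) (sin _) (sin _) (\prod_(_ < _ | _) _) => a b c d p.
by field.
Qed.

Lemma Lambda_gt0 (R : realType) (v : nat) (k : multi_index v) : 0 < Lambda R k.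
Proof. by apply: powR_gt0; rewrite ltr_pwDl// sqrtr_ge0. Qed.

(** * From vanishing cost to weak convergence *)

Lemma cvg_time_avg_Fk (R : realType) (n v : nat) (L : 'I_v -> R)
    (h : multi_index v -> R) (g : 'rV[R]_n -> 'rV[R]_v)
    (mu : probability (borelRV R v) R) (x : R -> 'rV[R]_n) (k : multi_index v) :
  spectral_cost L h g mu x T @[T --> +oo] --> (0%R)%:E ->
  time_avg g x T (Fk L h k) @[T --> +oo] --> Rintegral mu (box L) (Fk L h k).
Proof.
move=> cost0; apply/cvgrPdist_lt => e e0.
(* A cost below this threshold forces the [k]-th deviation below [e]. *)
have Le : 0 < Lambda R k * e ^+ 2 by rewrite mulr_gt0 ?Lambda_gt0 ?exprn_gt0.
near=> T.
have costT : (spectral_cost L h g mu x T < (Lambda R k * e ^+ 2)%:E)%E.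
  near: T.
  exact: cost0 _ (nbhs_open_ereal_lt (f := fun=> Lambda R k * e ^+ 2) Le).
have /le_lt_trans/(_ costT) : ((Lambda R k * (time_avg g x T (Fk L h k)
    - Rintegral mu (box L) (Fk L h k)) ^+ 2)%:E <= spectral_cost L h g mu x T)%E.
  (* The sum is a supremum over finite index sets; the singleton isolates one term. *)
  apply: esum_ge; exists [set k]; first by split=> //; exact: finite_set1.
  by rewrite fsbig_set1.
rewrite lte_fin ltr_pM2l ?Lambda_gt0// -sqrrN opprB.
by rewrite -[X in X < _]real_normK ?num_real// ltr_sqr ?nnegrE// ltW.
Unshelve. all: by end_near. Qed.

Theorem theorem2 (R : realType) (n v : nat) (X : set 'rV[R]_n)
  (L : 'I_v -> R) (hL : forall i, 0 < L i)
  (g : 'rV[R]_n -> 'rV[R]_v)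
  (hgW : forall y, X y -> box L (g y))
  (hgm : borel_measurable_on X g)
  (mu : probability (borelRV R v) R) (hmuW : mu (box L) = 1%E)
  (h : multi_index v -> R) (hh : forall k, 0 < h k) :
  forall x : R -> 'rV[R]_n,
    {within `[0, +oo[, continuous x} ->
    (forall t, 0 <= t -> X (x t)) ->
    spectral_cost L h g mu x T @[T --> +oo] --> (0%R)%:E ->
    forall phi : 'rV[R]_v -> R, {within box L, continuous phi} ->
      time_avg g x T phi @[T --> +oo] --> Rintegral mu (box L) phi.
Proof.
move=> x cx Xx cost0 phi cphi.
have mbox : @measurable _ (borelRV R v) (box L) := measurable_box L.
have mu_fin : (mu (box L) < +oo)%E by rewrite hmuW ltry.
have mid : measurable_fun (box L : set (borelRV R v)) (id : 'rV[R]_v -> borelRV R v).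
  exact: measurable_id.
have mT T : measurable (`[0, T] : set R) by [].
have T_fin (T : R) : (@lebesgue_measure R `[0%R, T] < +oo)%E.
  by rewrite lebesgue_measure_itv; case: ifP => _; rewrite ltry.
have gxW (T t : R) : `[0, T]%classic t -> box L (g (x t)).
  by rewrite /= in_itv /= => /andP[t0 _]; apply: hgW; exact: Xx.
have mgx (T : R) := trajectory_measurable (T := T) hgm cx Xx.
have avg_linear (T a : R) (f1 f2 : 'rV[R]_v -> R) :
    continuous f1 -> continuous f2 ->
    time_avg g x T (fun w => a * f1 w + f2 w) =
    a * time_avg g x T f1 + time_avg g x T f2.
  move=> c1 c2; rewrite /time_avg.
  rewrite (box_integral_linear (m := @lebesgue_measure R) (mT T) (T_fin T)
    (gxW T) (mgx T))//.
  by rewrite mulrDr mulrCA.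
have mu_linear (a : R) (f1 f2 : 'rV[R]_v -> R) :
    continuous f1 -> continuous f2 ->
    Rintegral mu (box L) (fun w => a * f1 w + f2 w) =
    a * Rintegral mu (box L) f1 + Rintegral mu (box L) f2.
  move=> c1 c2.
  exact: (box_integral_linear (m := mu) mbox mu_fin (fun _ => id) mid).
pose conv (f : 'rV[R]_v -> R) :=
  time_avg g x T f @[T --> +oo] --> Rintegral mu (box L) f.
have conv_linear (a : R) (f1 f2 : 'rV[R]_v -> R) :
    continuous f1 -> continuous f2 -> conv f1 -> conv f2 ->
    conv (fun w => a * f1 w + f2 w).
  move=> c1 c2 v1 v2; rewrite /conv mu_linear//.
  under eq_fun do rewrite avg_linear//.
  by apply: cvgD => //; apply: cvgM => //; exact: cvg_cst.
pose e_ := @cos_prod R v L.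
have ce k : continuous (e_ k) := @continuous_cos_prod R v L k.
have cF k : continuous (Fk L h k).
  move=> w; apply: (@continuousM R 'rV[R]_v); [exact: cst_continuous|exact: ce].
have conv_scale (a : R) (f : 'rV[R]_v -> R) :
    continuous f -> conv f -> conv (fun w => a * f w).
  (* Scaling is read off from linearity as [(a - 1) * f + f]. *)
  move=> cf vf; have := conv_linear (a - 1) _ _ cf cf vf vf; congr conv.
  by apply/funext => w; ring.
have conv_e k : conv (e_ k).
  have := conv_scale (h k) _ (cF k) (cvg_time_avg_Fk (k := k) cost0); congr conv.
  by apply/funext => w; rewrite /Fk mulrA divff ?mul1r// gt_eqF.
have ccst (a : R) : continuous ((fun=> a) : 'rV[R]_v -> R).
  by move=> w; exact: cst_continuous.
(* Quantifying over all [k] makes [D] stable under the cosines: the extra cosine is absorbed into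
   [e_ k], producing other indices. Continuity is carried along for integrability. *)
pose D (f : 'rV[R]_v -> R) :=
  continuous f /\ forall k, conv (fun w => f w * e_ k w).
have cM (f1 f2 : 'rV[R]_v -> R) : continuous f1 -> continuous f2 ->
    continuous (fun w => f1 w * f2 w).
  by move=> c1 c2 w; apply: (@continuousM R 'rV[R]_v); [exact: c1|exact: c2].
have cD (f1 f2 : 'rV[R]_v -> R) : continuous f1 -> continuous f2 ->
    continuous (fun w => f1 w + f2 w).
  by move=> c1 c2 w; apply: (@continuousD R R 'rV[R]_v); [exact: c1|exact: c2].
have D1 : D (fun=> 1).
  split=> [|k]; first exact: ccst.
  by have := conv_e k; congr conv; apply/funext => w; rewrite mul1r.
have Dlin a f1 f2 : D f1 -> D f2 -> D (fun w => a * f1 w + f2 w).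
  move=> [c1 v1] [c2 v2]; split=> [|k].
    by apply: cD => //; apply: cM.
  have := conv_linear a _ _ (cM _ _ c1 (ce k)) (cM _ _ c2 (ce k)) (v1 k) (v2 k).
  by congr conv; apply/funext => w; ring.
have Dcos i f : D f -> D (fun w => cos (angle L i w) * f w).
  move=> [cf vf]; split=> [|k].
    apply: cM => // w.
    by apply: continuous_comp; [exact: continuous_angle|exact: continuous_cos].
  case ki : (k i) => [|m].
    have := vf (set_index k i 1); congr conv; apply/funext => w.
    by rewrite /e_ -(cos_mul_cos_prod0 _ _ ki); ring.
  have cfe k' := cM _ _ cf (ce k').
  have := conv_linear 2^-1 _ _ (cfe _)
    (cM _ _ (ccst _) (cfe _)) (vf (set_index k i m.+2))
    (conv_scale 2^-1 _ (cfe _) (vf (set_index k i m))).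
  congr conv; apply/funext => w.
  rewrite [in RHS]mulrAC (cos_mul_cos_prodS _ _ ki) /e_.
  by move: (cos_prod _ _ _) (cos_prod _ _ _) => y z; ring.
(* Both integrals only see values on the box, where [phi'] agrees with [phi]. *)
pose phi' := phi \o clip L.
have cphi' : continuous phi'.
  apply: (continuous_comp_within (@continuous_clip R v L) _ cphi) => w.
  exact: box_clip.
have phi'E w : box L w -> phi w = phi' w by move=> bw; rewrite /phi' /= clip_id.
have -> : Rintegral mu (box L) phi = Rintegral mu (box L) phi'.
  by apply: eq_Rintegral => w /set_mem; exact: phi'E.
have avgE T : time_avg g x T phi = time_avg g x T phi'.
  congr (_ * _); apply: eq_Rintegral => t /set_mem tT; apply: phi'E.
  exact: gxW tT.
under eq_fun do rewrite avgE.
apply/cvgrPdist_lt => e e0.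
(* Three errors of at most [e / 4] each: [phi'] against [f] under [mu], the same under the time
   average, and the convergence for [f]. *)
have e40 : 0 < e / 4 by rewrite divr_gt0.
have [f [cf vf] fphi] := cos_algebra_dense hL D1 Dlin Dcos cphi' e40.
have conv_f : conv f.
  (* At the zero index [e_ k] is the constant 1. *)
  have := vf (fun=> 0%N); congr conv; apply/funext => w.
  by rewrite /e_ /cos_prod big1 ?mulr1// => i _; rewrite mulr0 !mul0r cos0.
have mu_dist : `|Rintegral mu (box L) phi' - Rintegral mu (box L) f| <= e / 4.
  have := box_integral_dist (m := mu) mbox mu_fin (fun _ => id) mid cphi' cf fphi.
  rewrite [X in _ <= _ * X](_ : _ = 1) ?mulr1//.
  exact: (congr1 fine hmuW).
near=> T.
have T0 : 0 < T by near: T; exact: nbhs_pinfty_gt.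
have avg_dist : `|time_avg g x T phi' - time_avg g x T f| <= e / 4.
  have leb : fine (@lebesgue_measure R `[0%R, T]) = T.
    by rewrite lebesgue_measure_itv /= lte_fin T0 /= subr0.
  have := box_integral_dist (m := @lebesgue_measure R) (mT T) (T_fin T)
    (gxW T) (mgx T) cphi' cf fphi.
  (* The integrals over [[0, T]] differ by at most [e / 4 * T]; the factor [T^-1] of the average
     cancels the length. *)
  rewrite [X in _ <= _ * X](_ : _ = T) => [dist|]; last exact: leb.
  rewrite /time_avg -mulrBr normrM gtr0_norm ?invr_gt0//.
  by rewrite mulrC ler_pdivrMr.
have fT : `|Rintegral mu (box L) f - time_avg g x T f| < e / 4.
  by near: T; exact: (cvgrPdist_lt _ _).1 conv_f _ e40.
move: mu_dist avg_dist fT; rewrite !(ler_norml, ltr_norml).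
move: (Rintegral mu _ phi') (Rintegral mu _ f).
move: (time_avg _ _ _ phi') (time_avg _ _ _ f) => a b c d.
by lra.
Unshelve. all: by end_near. Qed.
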